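(* Let $m,b,c_1,c_2\ge1$ be integers with $b$ dividing $m$, and put $c=c_1+c_2$. Let $Q=[\bar{Q},\tilde{Q}]$, $K=[\bar{K},\tilde{K}]$, $V=[\bar{V},\tilde{V}]\in\mathbb{R}^{m\times c}$ with $\bar{Q},\bar{K},\bar{V}\in\mathbb{R}^{m\times c_1}$ and $\tilde{Q},\tilde{K},\tilde{V}\in\mathbb{R}^{m\times c_2}$. Let $U_m\in\mathbb{R}^{m\times m}$ be the all-ones matrix and $Z=I_b\otimes U_{m/b}\in\mathbb{R}^{m\times m}$. Write $\bar{q}_{i_1}$ and $\bar{k}_{i_2}$ for the $i_1$-th row of $\bar{Q}$ and the $i_2$-th row of $\bar{K}$, with $j$-th entries $\bar{q}_{i_1j}$, $\bar{k}_{i_2j}$, and let $\mathfrak{M}>0$ and $\mathscr{M}>0$ be respectively the maximum and the minimum of $\exp\left(\bar{q}_{i_1}\bar{k}_{i_2}^{\top}+0.5-(\bar{q}_{i_1j}+\bar{k}_{i_2j})\right)$ over $1\le i_1,i_2\le m$ and $1\le j\le c_1$. Let $\xi\in\{2,F\}$, and set $\gamma=\left|\frac{c_1}{\mathscr{M}\exp(-0.5)}-1\right|$ if $\left|\frac{c_1}{\mathscr{M}\exp(-0.5)}-1\right|\ge\left|\frac{c_1}{\mathfrak{M}\exp(-0.5)}-1\right|$, and $\gamma=\left|\frac{c_1}{\mathfrak{M}\exp(-0.5)}-1\right|$ otherwise. Then $$\left\|\left[\exp(\bar{Q})\exp(\bar{K})^{\top}\bar{V},\ \left(\exp(\tilde{Q}\tilde{K}^{\top})\odot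 Z\right)\tilde{V}\right]-\exp(QK^{\top})V\right\|_\xi$$ $$\le\left\|\exp(\bar{Q})\exp(\bar{K})^{\top}-\exp(\bar{Q}\bar{K}^{\top})\odot\exp(\tilde{Q}\tilde{K}^{\top})\right\|_\xi\|\bar{V}\|_\xi+\left\|\exp(\tilde{Q}\tilde{K}^{\top})\odot Z-\exp(\bar{Q}\bar{K}^{\top})\odot\exp(\tilde{Q}\tilde{K}^{\top})\right\|_\xi\|\tilde{V}\|_\xi$$ $$\le\left(\frac{c_1}{\mathscr{M}\exp(-0.5)}\left\|U_m-\exp(\tilde{Q}\tilde{K}^{\top})\right\|_\xi+\gamma\left\|\exp(\tilde{Q}\tilde{K}^{\top})\right\|_\xi\right)\left\|\exp(\bar{Q}\bar{K}^{\top})\right\|_\xi\|\bar{V}\|_\xi+\left\|Z-\exp(\bar{Q}\bar{K}^{\top})\right\|_\xi\left\|\exp(\tilde{Q}\tilde{K}^{\top})\right\|_\xi\|\tilde{V}\|_\xi .$$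
   Context: The function $\exp$ applied to a matrix acts entrywise (it is not the matrix exponential). $\odot$ is the Hadamard (entrywise) product, $\otimes$ the Kronecker product, $I_b$ the $b\times b$ identity matrix, $U_{n}$ the $n\times n$ all-ones matrix, and $[A,B]$ horizontal concatenation. Thus $Z$ is block diagonal with $b$ all-ones blocks of size $m/b$. $\|\cdot\|_2$ is the spectral norm and $\|\cdot\|_F$ the Frobenius norm; $\|\cdot\|_\xi$ denotes either one, the same choice throughout. All vectors are row vectors. *)

(* Defs.v *)
From HB Require Import structures.
From mathcomp Require Import all_boot all_order all_algebra.
From mathcomp Require Import all_classical all_reals all_analysis.
From mathcomp Require Import mxtens.

Set Implicit Arguments.
Unset Strict Implicit.
Unset Printing Implicit Defensive.

Import Order.TTheory GRing.Theory Num.Theory.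
Local Open Scope classical_set_scope.
Local Open Scope ring_scope.

Definition expmx (R : realType) m n (A : 'M[R]_(m, n)) : 'M[R]_(m, n) :=
  map_mx expR A.

Definition hadamard (R : realType) m n (A B : 'M[R]_(m, n)) : 'M[R]_(m, n) :=
  map2_mx *%R A B.

Notation "A ⊙ B" := (hadamard A B) (at level 40, left associativity) : ring_scope.

Definition frobenius (R : realType) m n (A : 'M[R]_(m, n)) : R :=
  Num.sqrt (\sum_(i < m) \sum_(j < n) A i j ^+ 2).

(* On column vectors, [frobenius] is the Euclidean norm. The set below is
   nonempty and bounded above, so [sup] is its true supremum. *)
Definition spectral (R : realType) m n (A : 'M[R]_(m, n)) : R :=
  sup [set frobenius (A *m x) | x in [set x : 'cV[R]_n | frobenius x <= 1]].

Variant norm_kind := Spectral | Frobenius.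

Definition xnorm (R : realType) (xi : norm_kind) m n (A : 'M[R]_(m, n)) : R :=
  match xi with
  | Spectral => spectral A
  | Frobenius => frobenius A
  end.

Notation "‖ A ‖_ xi" := (xnorm xi A)
  (at level 0, A at level 99, xi at level 0, format "‖ A ‖_ xi") : ring_scope.

Lemma mul_divn_dvd b m : (b %| m)%N -> (b * (m %/ b) = m)%N.
Proof. by move=> hb; rewrite mulnC divnK. Qed.

Definition blockones (R : realType) b m (hb : (b %| m)%N) : 'M[R]_m :=
  castmx (mul_divn_dvd hb, mul_divn_dvd hb)
    ((1%:M : 'M[R]_b) *t (const_mx 1 : 'M[R]_(m %/ b))).

Definition ratio_term (R : realType) m c1 (Qb Kb : 'M[R]_(m, c1))
    (i1 i2 : 'I_m) (j : 'I_c1) : R :=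
  expR ((row i1 Qb *m (row i2 Kb)^T) 0 0 + 2^-1 - (Qb i1 j + Kb i2 j)).

Definition ratio_terms (R : realType) m c1 (Qb Kb : 'M[R]_(m, c1)) : set R :=
  [set r | exists i1 i2 j, r = ratio_term Qb Kb i1 i2 j].

Definition is_maximum (R : realType) (S : set R) (x : R) := S x /\ ubound S x.
Definition is_minimum (R : realType) (S : set R) (x : R) := S x /\ lbound S x.

Definition gamma_coef (R : realType) (c1 : nat) (Mmin Mmax : R) : R :=
  let gmin := `|c1%:R / (Mmin * expR (- 2^-1)) - 1| in
  let gmax := `|c1%:R / (Mmax * expR (- 2^-1)) - 1| in
  if gmin >= gmax then gmin else gmax.

(* Main.v *)
(** Put [S = exp(Qb Kb^T)] and [T = exp(Qt Kt^T)], so that [exp(Q K^T) = S ⊙ T]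
and the first inequality is subadditivity plus submultiplicativity.  For the
second, [exp(Qb) exp(Kb)^T = S ⊙ D], where each entry of [D] is a sum over [j]
of inverses of [ratio_term * exp(-1/2)] and hence lies between
[c1 / (Mmax exp(-1/2))] and [c1 / (Mmin exp(-1/2))].  Then
[S ⊙ D - S ⊙ T = (S ⊙ D) ⊙ (U - T) + (D - U) ⊙ (S ⊙ T)].  An entrywise factor
cannot be pulled out of a spectral norm in general, but it can here because it
multiplies the nonnegative matrices [S] and [S ⊙ T]; both norms are moreover
submultiplicative for the Hadamard product. *)

Require Import Defs.
From mathcomp Require Import all_boot all_order all_algebra.
From mathcomp Require Import all_classical all_reals all_analysis.
From mathcomp Require Import ring lra.

Set Implicit Arguments.
Unset Strict Implicit.
Unset Printing Implicit Defensive.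

Import Order.TTheory GRing.Theory Num.Theory.
Local Open Scope ring_scope.

(** * The Frobenius norm and its inequalities *)

Section Frobenius.
Variable R : realType.

(** Lagrange's identity: the sum of all [(f i * g j - f j * g i) ^+ 2] is twice the gap between the
    two sides. *)
Lemma sum_cauchy_schwarz (I : finType) (f g : I -> R) :
  (\sum_i f i * g i) ^+ 2 <= (\sum_i f i ^+ 2) * (\sum_i g i ^+ 2).
Proof.
have h : 0 <= \sum_i \sum_j (f i * g j - f j * g i) ^+ 2.
  by apply: sumr_ge0 => i _; apply: sumr_ge0 => j _; exact: sqr_ge0.
suff e : \sum_i \sum_j (f i * g j - f j * g i) ^+ 2 =
   (\sum_i f i ^+ 2) * (\sum_i g i ^+ 2) *+ 2 - (\sum_i f i * g i) ^+ 2 *+ 2.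
  by rewrite e subr_ge0 lerMn2r in h.
have -> : (\sum_i f i ^+ 2) * (\sum_i g i ^+ 2) *+ 2 =
   \sum_i \sum_j f i ^+ 2 * g j ^+ 2 + \sum_i \sum_j f j ^+ 2 * g i ^+ 2.
  rewrite mulr2n; congr (_ + _).
    by rewrite mulr_suml; apply: eq_bigr => i _; rewrite mulr_sumr.
  rewrite mulrC mulr_suml; apply: eq_bigr => i _; rewrite mulr_sumr.
  by apply: eq_bigr => j _; rewrite mulrC.
have -> : (\sum_i f i * g i) ^+ 2 *+ 2 =
   \sum_i \sum_j (f i * g i * (f j * g j)) *+ 2.
  rewrite expr2 mulr_suml -sumrMnl; apply: eq_bigr => i _.
  by rewrite mulr_sumr -sumrMnl.
rewrite -big_split -sumrB; apply: eq_bigr => i _ /=.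
rewrite -big_split -sumrB; apply: eq_bigr => j _ /=.
by ring.
Qed.

Lemma frobenius_ge0 m n (A : 'M[R]_(m, n)) : 0 <= frobenius A.
Proof. exact: sqrtr_ge0. Qed.
Local Hint Extern 0 (is_true (@Order.le _ _ _ (frobenius _))) =>
  exact: frobenius_ge0 : core.

Lemma frobenius_sqr m n (A : 'M[R]_(m, n)) :
  frobenius A ^+ 2 = \sum_i \sum_j A i j ^+ 2.
Proof.
by rewrite sqr_sqrtr//; do 2![apply: sumr_ge0 => ? _]; exact: sqr_ge0.
Qed.

Lemma frobenius_sqr_col m (x : 'cV[R]_m) :
  frobenius x ^+ 2 = \sum_i x i 0 ^+ 2.
Proof. by rewrite frobenius_sqr; apply: eq_bigr => i _; rewrite big_ord1. Qed.

Lemma frobenius_le m n p q (A : 'M[R]_(m, n)) (B : 'M[R]_(p, q)) c : 0 <= c ->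
  \sum_i \sum_j A i j ^+ 2 <= c ^+ 2 * \sum_i \sum_j B i j ^+ 2 ->
  frobenius A <= c * frobenius B.
Proof.
move=> c0; rewrite -!frobenius_sqr -exprMn ler_pXn2r// ?nnegrE//.
exact: mulr_ge0.
Qed.

Lemma frobenius0 m n : frobenius (0 : 'M[R]_(m, n)) = 0.
Proof.
apply/eqP; rewrite -sqrf_eq0 frobenius_sqr; apply/eqP.
by do 2![apply: big1 => ? _]; rewrite mxE expr0n.
Qed.

Lemma frobenius_mono m n (A B : 'M[R]_(m, n)) c : 0 <= c ->
  (forall i j, `|A i j| <= c * `|B i j|) -> frobenius A <= c * frobenius B.
Proof.
move=> c0 h; apply: frobenius_le => //; rewrite mulr_sumr.
apply: ler_sum => i _; rewrite mulr_sumr; apply: ler_sum => j _.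
rewrite -(real_normK (num_real (A i j))) -(real_normK (num_real (B i j))).
by rewrite -exprMn ler_pXn2r ?nnegrE ?mulr_ge0.
Qed.

Lemma frobenius_abs m n (A : 'M[R]_(m, n)) :
  frobenius (map_mx Num.norm A) = frobenius A.
Proof.
congr Num.sqrt; do 2![apply: eq_bigr => ? _].
by rewrite mxE real_normK ?num_real.
Qed.

Lemma frobeniusZ m n c (A : 'M[R]_(m, n)) :
  frobenius (c *: A) = `|c| * frobenius A.
Proof.
rewrite /frobenius -sqrtr_sqr -sqrtrM ?sqr_ge0//; congr Num.sqrt.
rewrite mulr_sumr; apply: eq_bigr => i _; rewrite mulr_sumr.
by apply: eq_bigr => j _; rewrite mxE exprMn.
Qed.

Lemma frobeniusD m n (A B : 'M[R]_(m, n)) :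
  frobenius (A + B) <= frobenius A + frobenius B.
Proof.
rewrite -(@ler_pXn2r _ 2) ?nnegrE ?addr_ge0//.
rewrite sqrrD !frobenius_sqr.
have -> : \sum_i \sum_j (A + B) i j ^+ 2 = \sum_i \sum_j A i j ^+ 2 +
    (\sum_i \sum_j A i j * B i j) *+ 2 + \sum_i \sum_j B i j ^+ 2.
  rewrite -sumrMnl -!big_split; apply: eq_bigr => i _ /=.
  rewrite -sumrMnl -!big_split; apply: eq_bigr => j _ /=.
  by rewrite mxE sqrrD.
rewrite lerD2r lerD2l lerMn2r /=.
apply: le_trans (ler_norm _) _.
rewrite -(@ler_pXn2r _ 2) ?nnegrE ?mulr_ge0//.
rewrite exprMn !frobenius_sqr real_normK ?num_real//.
(* Indexing by pairs [(i, j)] turns the cross term into a single inner product. *)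
rewrite !pair_bigA; exact: sum_cauchy_schwarz.
Qed.

Lemma frobeniusM m n p (A : 'M[R]_(m, n)) (B : 'M[R]_(n, p)) :
  frobenius (A *m B) <= frobenius A * frobenius B.
Proof.
(* Summing [B] column by column lets Cauchy-Schwarz pair row [i] of [A] with column [j] of [B]. *)
apply: frobenius_le => //; rewrite frobenius_sqr [X in _ * X]exchange_big.
rewrite mulr_suml; apply: ler_sum => i _; rewrite mulr_sumr.
by apply: ler_sum => j _; rewrite mxE; exact: sum_cauchy_schwarz.
Qed.

Lemma frobenius_row_mx m n p (A : 'M[R]_(m, n)) (B : 'M[R]_(m, p)) :
  frobenius (row_mx A B) ^+ 2 = frobenius A ^+ 2 + frobenius B ^+ 2.
Proof.
rewrite !frobenius_sqr -big_split; apply: eq_bigr => i _ /=.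
by rewrite big_split_ord /=; congr (_ + _); apply: eq_bigr => j _;
  rewrite ?row_mxEl ?row_mxEr.
Qed.

Lemma frobenius_col_mx m n p (A : 'M[R]_(m, p)) (B : 'M[R]_(n, p)) :
  frobenius (col_mx A B) ^+ 2 = frobenius A ^+ 2 + frobenius B ^+ 2.
Proof.
rewrite !frobenius_sqr big_split_ord /=.
by congr (_ + _); do 2![apply: eq_bigr => ? _]; rewrite ?col_mxEu ?col_mxEd.
Qed.

Lemma ler_frobenius_entry m n (A : 'M[R]_(m, n)) i j : `|A i j| <= frobenius A.
Proof.
rewrite -(@ler_pXn2r _ 2) ?nnegrE// real_normK ?num_real// frobenius_sqr.
rewrite (bigD1 i)//= (bigD1 j)//= -addrA lerDl addr_ge0//.
  by apply: sumr_ge0 => ? _; exact: sqr_ge0.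
by do 2![apply: sumr_ge0 => ? _]; exact: sqr_ge0.
Qed.

(** Every entry of [A] is at most [frobenius A] in absolute value, so this scalar can replace the
    factor [A]. *)
Lemma frobenius_hadamard m n (A B : 'M[R]_(m, n)) :
  frobenius (A ⊙ B) <= frobenius A * frobenius B.
Proof.
apply: frobenius_mono => // i j.
by rewrite mxE normrM ler_wpM2r// ler_frobenius_entry.
Qed.

End Frobenius.
#[local] Hint Extern 0 (is_true (@Order.le _ _ _ (frobenius _))) =>
  exact: frobenius_ge0 : core.

(** * The spectral norm and its inequalities *)

Section Spectral.
Variable R : realType.

Lemma spectral_has_sup m n (A : 'M[R]_(m, n)) :
  has_sup [set frobenius (A *m x) | x in [set x : 'cV[R]_n | frobenius x <= 1]]%classic.
Proof.
split; first by exists (frobenius (A *m (0 : 'cV[R]_n))); exists 0 => //=; rewrite frobenius0.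
exists (frobenius A) => _ [x /= x1 <-].
by apply: le_trans (frobeniusM _ _) _; rewrite ler_piMr.
Qed.

Lemma spectral_ge0 m n (A : 'M[R]_(m, n)) : 0 <= spectral A.
Proof.
apply: le_trans (frobenius_ge0 (A *m (0 : 'cV[R]_n))) _.
apply: ub_le_sup; first by have [] := spectral_has_sup A.
by exists 0 => //=; rewrite frobenius0.
Qed.
Local Hint Extern 0 (is_true (@Order.le _ _ _ (spectral _))) =>
  exact: spectral_ge0 : core.

(** By homogeneity: a vector of nonzero norm, rescaled to norm 1, belongs to the set whose supremum
    is [spectral A]. *)
Lemma frobenius_spectral m n (A : 'M[R]_(m, n)) (x : 'cV[R]_n) :
  frobenius (A *m x) <= spectral A * frobenius x.
Proof.
have [x0|xn0] := eqVneq (frobenius x) 0.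
  by rewrite x0 mulr0 (le_trans (frobeniusM _ _))// x0 mulr0.
have xp : 0 < frobenius x by rewrite lt_neqAle eq_sym xn0 frobenius_ge0.
rewrite -ler_pdivrMr// mulrC.
have <- : frobenius (A *m ((frobenius x)^-1 *: x)) =
    (frobenius x)^-1 * frobenius (A *m x).
  by rewrite -scalemxAr frobeniusZ ger0_norm ?invr_ge0.
apply: ub_le_sup; first by have [] := spectral_has_sup A.
exists ((frobenius x)^-1 *: x) => //=; by rewrite frobeniusZ ger0_norm ?invr_ge0// mulVf.
Qed.

Lemma spectral_le m n (A : 'M[R]_(m, n)) c : 0 <= c ->
  (forall x : 'cV[R]_n, frobenius (A *m x) <= c * frobenius x) ->
  spectral A <= c.
Proof.
move=> c0 h; apply: ge_sup; first by have [] := spectral_has_sup A.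
by move=> _ [x /= x1 <-]; rewrite (le_trans (h x))// ler_piMr.
Qed.

(** Replacing [x] by its entrywise absolute value keeps its norm, and each entry of [A *m x] is then
    dominated by the same entry of [c *: (B *m |x|)]. This is where the sign of [B] matters:
    cancellation in [B *m |x|] would break the bound. *)
Lemma spectral_mono m n (A B : 'M[R]_(m, n)) c : 0 <= c ->
  (forall i j, `|A i j| <= c * B i j) -> spectral A <= c * spectral B.
Proof.
move=> c0 h; apply: spectral_le => [|x]; first exact: mulr_ge0.
rewrite -(frobenius_abs x) -mulrA.
apply: le_trans (ler_wpM2l c0 (frobenius_spectral _ _)).
apply: frobenius_mono => // i j; rewrite !mxE.
apply: le_trans (ler_norm_sum _ _ _) _.
apply: le_trans (ler_wpM2l c0 (ler_norm _)); rewrite mulr_sumr.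
by apply: ler_sum => k _; rewrite normrM mxE mulrA ler_wpM2r.
Qed.

Lemma spectralD m n (A B : 'M[R]_(m, n)) :
  spectral (A + B) <= spectral A + spectral B.
Proof.
apply: spectral_le => [|x]; first exact: addr_ge0.
rewrite mulmxDl mulrDl (le_trans (frobeniusD _ _))//.
by rewrite lerD ?frobenius_spectral.
Qed.

Lemma spectralM m n p (A : 'M[R]_(m, n)) (B : 'M[R]_(n, p)) :
  spectral (A *m B) <= spectral A * spectral B.
Proof.
apply: spectral_le => [|x]; first exact: mulr_ge0.
rewrite -mulmxA -mulrA (le_trans (frobenius_spectral _ _))//.
by rewrite ler_wpM2l ?frobenius_spectral.
Qed.

(** Split the test vector in two: [A] and [B] each act on one half, whose norm is at most that of
    the whole. *)
Lemma spectral_row_mx m n p (A : 'M[R]_(m, n)) (B : 'M[R]_(m, p)) :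
  spectral (row_mx A B) <= spectral A + spectral B.
Proof.
apply: spectral_le => [|x]; first exact: addr_ge0.
rewrite -(vsubmxK x) mul_row_col mulrDl (le_trans (frobeniusD _ _))//.
have h (y : 'cV[R]_n) (z : 'cV[R]_p) :
    frobenius y <= frobenius (col_mx y z) /\ frobenius z <= frobenius (col_mx y z).
  by split; rewrite -(@ler_pXn2r _ 2) ?nnegrE// frobenius_col_mx;
    rewrite ?lerDl ?lerDr sqr_ge0.
have [hu hd] := h (usubmx x) (dsubmx x).
by rewrite lerD// (le_trans (frobenius_spectral _ _))// ler_wpM2l.
Qed.

(** Test [A] on its own [i]-th row, of norm [r]: this gives [r ^+ 2 <= spectral A * r], and a
    nonzero [r] cancels. *)
Lemma spectral_row_norm m n (A : 'M[R]_(m, n)) i :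
  \sum_j A i j ^+ 2 <= spectral A ^+ 2.
Proof.
set s := \sum_j _.
have s0 : 0 <= s by apply: sumr_ge0 => ? _; exact: sqr_ge0.
have sE : s = frobenius (row i A)^T ^+ 2.
  by rewrite frobenius_sqr_col; apply: eq_bigr => j _; rewrite !mxE.
have h : s <= spectral A * frobenius (row i A)^T.
  apply: le_trans (frobenius_spectral _ _).
  (* Entry [i] of the image vector is [s] itself. *)
  apply: le_trans (ler_frobenius_entry _ i 0).
  rewrite mxE (le_trans _ (ler_norm _))//.
  by under [leRHS]eq_bigr do rewrite !mxE -expr2.
move: h; rewrite sE expr2; set r := frobenius _ => h.
have r0 : 0 <= r by exact: frobenius_ge0.
have [->|rn0] := eqVneq r 0; first by rewrite mul0r sqr_ge0.
have {h} h : r <= spectral A.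
  by rewrite -(@ler_pM2r _ r)// lt_neqAle eq_sym rn0.
by rewrite -expr2 ler_pXn2r ?nnegrE.
Qed.

(** Column [j] is the image of the [j]-th basis vector, which has norm 1. *)
Lemma spectral_col_norm m n (A : 'M[R]_(m, n)) j :
  \sum_i A i j ^+ 2 <= spectral A ^+ 2.
Proof.
have := frobenius_spectral A (delta_mx j 0).
have -> : frobenius (delta_mx j 0 : 'cV[R]_n) = 1.
  apply/eqP; rewrite -(@eqrXn2 _ 2) ?expr1n// frobenius_sqr_col.
  rewrite (bigD1 j)//= mxE !eqxx expr1n big1 ?addr0// => k /negbTE kj.
  by rewrite mxE kj expr0n.
rewrite mulr1 -colE -(@ler_pXn2r _ 2) ?nnegrE// frobenius_sqr_col.
by under eq_bigr do rewrite mxE.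
Qed.

(* Cauchy-Schwarz bounds the left side by the largest row norm of A times the
   largest column norm of B, and each of these is at most the spectral norm. *)
Lemma spectral_hadamard m n (A B : 'M[R]_(m, n)) :
  spectral (A ⊙ B) <= spectral A * spectral B.
Proof.
apply: spectral_le => [|x]; first exact: mulr_ge0.
rewrite -(@ler_pXn2r _ 2) ?nnegrE ?mulr_ge0// !exprMn !frobenius_sqr_col.
apply: (@le_trans _ _ (\sum_i spectral A ^+ 2 * \sum_j B i j ^+ 2 * x j 0 ^+ 2)).
  apply: ler_sum => i _; rewrite mxE.
  under eq_bigr do rewrite mxE -mulrA.
  apply: le_trans (sum_cauchy_schwarz _ _) _.
  under [X in _ * X]eq_bigr do rewrite exprMn.
  rewrite ler_wpM2r ?spectral_row_norm//.
  by apply: sumr_ge0 => j _; rewrite mulr_ge0 ?sqr_ge0.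
rewrite -mulr_sumr -mulrA ler_wpM2l ?sqr_ge0// exchange_big mulr_sumr /=.
apply: ler_sum => j _.
by rewrite -mulr_suml ler_wpM2r ?sqr_ge0 ?spectral_col_norm.
Qed.

End Spectral.

(** * Properties shared by both norms *)

Section Xnorm.
Variables (R : realType) (xi : norm_kind).

Lemma xnorm_ge0 m n (A : 'M[R]_(m, n)) : 0 <= ‖ A ‖_xi.
Proof. by case: xi => /=; [exact: spectral_ge0 | exact: frobenius_ge0]. Qed.

(** The bound uses [B i j] without absolute value because the spectral case requires it; this is the
    tool for pulling an entrywise factor out of a norm. *)
Lemma xnorm_mono m n (A B : 'M[R]_(m, n)) c : 0 <= c ->
  (forall i j, `|A i j| <= c * B i j) -> ‖ A ‖_xi <= c * ‖ B ‖_xi.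
Proof.
move=> c0 h; case: xi => /=; first exact: spectral_mono.
apply: frobenius_mono => // i j.
by rewrite (le_trans (h i j))// ler_wpM2l// ler_norm.
Qed.

Lemma xnormD m n (A B : 'M[R]_(m, n)) : ‖ A + B ‖_xi <= ‖ A ‖_xi + ‖ B ‖_xi.
Proof. by case: xi => /=; [exact: spectralD | exact: frobeniusD]. Qed.

Lemma xnormM m n p (A : 'M[R]_(m, n)) (B : 'M[R]_(n, p)) :
  ‖ A *m B ‖_xi <= ‖ A ‖_xi * ‖ B ‖_xi.
Proof. by case: xi => /=; [exact: spectralM | exact: frobeniusM]. Qed.

Lemma xnorm_hadamard m n (A B : 'M[R]_(m, n)) :
  ‖ A ⊙ B ‖_xi <= ‖ A ‖_xi * ‖ B ‖_xi.
Proof.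
by case: xi => /=; [exact: spectral_hadamard | exact: frobenius_hadamard].
Qed.

Lemma xnorm_row_mx m n p (A : 'M[R]_(m, n)) (B : 'M[R]_(m, p)) :
  ‖ row_mx A B ‖_xi <= ‖ A ‖_xi + ‖ B ‖_xi.
Proof.
case: xi => /=; first exact: spectral_row_mx.
(* For Frobenius, squares add up, and the square of the sum exceeds this by a nonnegative cross
   term. *)
rewrite -(@ler_pXn2r _ 2) ?nnegrE ?addr_ge0// frobenius_row_mx sqrrD.
by rewrite -addrA addrCA lerDr mulrn_wge0// mulr_ge0.
Qed.

End Xnorm.

(** A point above 1 is no farther from 1 than the upper endpoint, a point below 1 no farther than
    the lower one; the conditional in [gamma_coef] selects the larger endpoint distance. *)
Lemma ler_dist1_gamma (R : realType) c (Mmin Mmax d : R) :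
  c%:R / (Mmax * expR (- 2^-1)) <= d -> d <= c%:R / (Mmin * expR (- 2^-1)) ->
  `|d - 1| <= gamma_coef c Mmin Mmax.
Proof.
rewrite /gamma_coef; set lo := _ / _; set hi := _ / _ => hl hh.
suff : `|d - 1| <= Num.max `|lo - 1| `|hi - 1|.
  by rewrite /= le_max; case: ifPn => [|/negbTE]; case/orP: (le_total `|lo - 1| `|hi - 1|); lra.
(* [lerP] also rewrites the norm of [d - 1]. *)
rewrite le_max; case: (lerP 1 d) => _; apply/orP; [right|left].
  by apply: le_trans (ler_norm _); rewrite lerB.
by rewrite [leRHS]distrC; apply: le_trans (ler_norm _); rewrite lerB.
Qed.

(** The block product is a sum of two products, and the scalar law for [expR] of a sum applies in
    each entry. *)
Lemma expmx_mul_row (R : realType) m n p q (A : 'M[R]_(m, p)) (B : 'M[R]_(m, q))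
    (C : 'M[R]_(n, p)) (D : 'M[R]_(n, q)) :
  expmx (row_mx A B *m (row_mx C D)^T) =
  expmx (A *m C^T) ⊙ expmx (B *m D^T).
Proof. by apply/matrixP => i j; rewrite tr_row_mx mul_row_col !mxE expRD. Qed.

(** * The entrywise quotient of the two kernels and its bounds *)

Section Ratio.
Variables (R : realType) (m c : nat) (Q K : 'M[R]_(m, c)).

(** The matrix [D] of the overview; the denominators are exponentials, hence nonzero. *)
Definition kernel_quotient : 'M[R]_m :=
  \matrix_(i, k) ((expmx Q *m (expmx K)^T) i k / expmx (Q *m K^T) i k).

Lemma kernel_quotientE :
  expmx Q *m (expmx K)^T = expmx (Q *m K^T) ⊙ kernel_quotient.
Proof.
apply/matrixP => i k; rewrite [RHS]mxE [kernel_quotient _ _]mxE.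
by rewrite mulrC divfK// mxE gt_eqF ?expR_gt0.
Qed.

(** Each summand is the exponential of [Q i j + K k j] minus the inner product of the rows; the
    factor [expR (- 2^-1)] cancels the one half in [ratio_term]. *)
Lemma kernel_quotient_sum i k : kernel_quotient i k =
  \sum_j (ratio_term Q K i k j * expR (- 2^-1))^-1.
Proof.
rewrite !mxE mulr_suml; apply: eq_bigr => j _.
rewrite /ratio_term !mxE -expRN -!expRD -expRN; congr expR.
have -> : \sum_l row i Q 0 l * (row k K)^T l 0 = \sum_l Q i l * K^T l k.
  by apply: eq_bigr => l _; rewrite !mxE.
by ring.
Qed.

(** All [c] summands are inverses, so an upper bound on the ratio terms becomes a lower bound here,
    and conversely in [kernel_quotient_le]. *)
Lemma kernel_quotient_ge (M : R) : 0 < M -> ubound (ratio_terms Q K) M ->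
  forall i k, c%:R / (M * expR (- 2^-1)) <= kernel_quotient i k.
Proof.
move=> M0 h i k; rewrite kernel_quotient_sum.
have -> : c%:R / (M * expR (- 2^-1)) = \sum_(j < c) (M * expR (- 2^-1))^-1.
  by rewrite sumr_const card_ord mulr_natl.
apply: ler_sum => j _.
rewrite lef_pV2 ?posrE ?mulr_gt0 ?expR_gt0// ler_wpM2r ?expR_ge0//.
by apply: h; exists i, k, j.
Qed.

Lemma kernel_quotient_le (M : R) : 0 < M -> lbound (ratio_terms Q K) M ->
  forall i k, kernel_quotient i k <= c%:R / (M * expR (- 2^-1)).
Proof.
move=> M0 h i k; rewrite kernel_quotient_sum.
have -> : c%:R / (M * expR (- 2^-1)) = \sum_(j < c) (M * expR (- 2^-1))^-1.
  by rewrite sumr_const card_ord mulr_natl.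
apply: ler_sum => j _.
rewrite lef_pV2 ?posrE ?mulr_gt0 ?expR_gt0// ler_wpM2r ?expR_ge0//.
by apply: h; exists i, k, j.
Qed.

End Ratio.

(** * The two-stage error bound *)

Theorem mainTheorem2 (R : realType) (m b c1 c2 : nat)
    (hm : (1 <= m)%N) (hb : (1 <= b)%N) (hc1 : (1 <= c1)%N) (hc2 : (1 <= c2)%N)
    (hbm : (b %| m)%N)
    (Qb Kb Vb : 'M[R]_(m, c1)) (Qt Kt Vt : 'M[R]_(m, c2))
    (Mmax Mmin : R) (hMmax0 : 0 < Mmax) (hMmin0 : 0 < Mmin)
    (hMmax : is_maximum (ratio_terms Qb Kb) Mmax)
    (hMmin : is_minimum (ratio_terms Qb Kb) Mmin)
    (xi : norm_kind) :
  let Q : 'M[R]_(m, c1 + c2) := row_mx Qb Qt in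
  let K : 'M[R]_(m, c1 + c2) := row_mx Kb Kt in
  let V : 'M[R]_(m, c1 + c2) := row_mx Vb Vt in
  let U : 'M[R]_m := const_mx 1 in
  let Z : 'M[R]_m := blockones R hbm in
  let gamma : R := gamma_coef c1 Mmin Mmax in
  let lhs :=
    ‖ row_mx (expmx Qb *m (expmx Kb)^T *m Vb)
             ((expmx (Qt *m Kt^T) ⊙ Z) *m Vt)
      - expmx (Q *m K^T) *m V ‖_xi in
  let mid :=
    ‖ expmx Qb *m (expmx Kb)^T
      - expmx (Qb *m Kb^T) ⊙ expmx (Qt *m Kt^T) ‖_xi * ‖ Vb ‖_xi
    + ‖ expmx (Qt *m Kt^T) ⊙ Z
        - expmx (Qb *m Kb^T) ⊙ expmx (Qt *m Kt^T) ‖_xi * ‖ Vt ‖_xi in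
  let rhs :=
    (c1%:R / (Mmin * expR (- 2^-1)) * ‖ U - expmx (Qt *m Kt^T) ‖_xi
     + gamma * ‖ expmx (Qt *m Kt^T) ‖_xi)
      * ‖ expmx (Qb *m Kb^T) ‖_xi * ‖ Vb ‖_xi
    + ‖ Z - expmx (Qb *m Kb^T) ‖_xi * ‖ expmx (Qt *m Kt^T) ‖_xi
      * ‖ Vt ‖_xi in
  lhs <= mid /\ mid <= rhs.

Proof.
move=> Q K V U Z gamma lhs mid rhs.
pose S := expmx (Qb *m Kb^T); pose T := expmx (Qt *m Kt^T).
pose D := kernel_quotient Qb Kb.
pose a := c1%:R / (Mmin * expR (- 2^-1)).
have Dlo := kernel_quotient_ge hMmax0 hMmax.2.
have Dhi := kernel_quotient_le hMmin0 hMmin.2.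
have S0 i j : 0 < S i j by rewrite mxE expR_gt0.
have a0 : 0 <= a by rewrite divr_ge0// mulr_ge0 ?expR_ge0// ltW.
have D0 i j : 0 <= D i j.
  by apply: le_trans (Dlo i j); rewrite divr_ge0// mulr_ge0 ?expR_ge0// ltW.
have g0 : 0 <= gamma by rewrite /gamma /gamma_coef /=; case: ifP.
split.
  (* The exact product also splits into column blocks, so the error is a concatenation in which [Vb]
     and [Vt] factor out on the right. *)
  rewrite /lhs /mid /Q /K /V expmx_mul_row mul_mx_row opp_row_mx add_row_mx.
  rewrite -!mulmxBl.
  by apply: le_trans (xnorm_row_mx _ _ _) _; rewrite lerD ?xnormM.
rewrite /mid /rhs -/S -/T; apply: lerD.
  rewrite ler_wpM2r ?xnorm_ge0// kernel_quotientE -/S -/D.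
  have -> : S ⊙ D - S ⊙ T = (S ⊙ D) ⊙ (U - T) + (S ⊙ (D - U)) ⊙ T.
    by apply/matrixP => i j; rewrite !mxE; ring.
  apply: le_trans (xnormD _ _ _) _; rewrite mulrDl; apply: lerD.
    (* [U - T] may have entries of either sign, so it is split off first; then [S ⊙ D] is dominated
       entrywise by [a *: S]. *)
    apply: le_trans (xnorm_hadamard _ _ _) _.
    rewrite [leRHS]mulrAC ler_wpM2r ?xnorm_ge0//.
    apply: xnorm_mono => // i j.
    have -> : (S ⊙ D) i j = D i j * S i j by rewrite mxE mulrC.
    by rewrite ger0_norm ?mulr_ge0 ?ler_wpM2r ?(ltW (S0 _ _)).
  (* Here the factor [D - U], bounded by [gamma], is removed while [S ⊙ T] is still whole; only then
     are [S] and [T] separated. *)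
  apply: (@le_trans _ _ (gamma * ‖ S ⊙ T ‖_xi)).
    apply: xnorm_mono => // i j; rewrite !mxE !normrM.
    rewrite (gtr0_norm (expR_gt0 _)) (gtr0_norm (expR_gt0 _)).
    rewrite mulrAC mulrC ler_wpM2r ?mulr_ge0 ?expR_ge0//.
    by have := ler_dist1_gamma (Dlo i j) (Dhi i j); rewrite !mxE.
  by rewrite -mulrA ler_wpM2l// mulrC xnorm_hadamard.
rewrite ler_wpM2r ?xnorm_ge0// mulrC.
have -> : T ⊙ Z - S ⊙ T = T ⊙ (Z - S).
  by apply/matrixP => i j; rewrite !mxE; ring.
exact: xnorm_hadamard.
Qed.
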